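(* Let $K$ be a field and let $(\mathcal C,\mathbb E,\mathfrak s)$ be a $K$-linear Krull-Schmidt extriangulated category such that $\dim_K\mathrm{Hom}_{\mathcal C}(X,Y)<\infty$ and $\dim_K\mathbb E(X,Y)<\infty$ for all $X,Y\in\mathcal C$, and such that not all objects of $\mathcal C$ are projective and injective. Assume that $\mathcal C$ is locally finite, and let $\psi:K_0(\mathcal C,0)\to K_0(\mathcal C)$ be the canonical epimorphism. Then $\mathrm{Ker}(\psi)$ is generated by the elements $[\delta]=[A]+[C]-[B]$ of $K_0(\mathcal C,0)$, where $A\xrightarrow{f}B\xrightarrow{g}C\overset{\delta}{\dashrightarrow}$ runs through all Auslander-Reiten $\mathbb E$-triangles in $\mathcal C$.
   Context: Extriangulated categories (Nakaoka-Palu). Let $\mathcal C$ be an additive category with a biadditive functor $\mathbb E:\mathcal C^{\mathrm{op}}\times\mathcal C\to \mathrm{Ab}$. An element $\delta\in\mathbb E(C,A)$ is an $\mathbb E$-extension; for $a:A\to A'$ and $c:C'\to C$ write $a_*\delta=\mathbb E(C,a)(\delta)$, $c^*\delta=\mathbb E(c,A)(\delta)$. A morphism from $\delta\in\mathbb E(C,A)$ to $\delta'\in\mathbb E(C',A')$ is a pair $(a,c)$, $a:A\to A'$, $c:C\to C'$, with $a_*\delta=c^*\delta'$. Sequences $A\to B\to C$ and $A\to B'\to C$ are equivalent if there is an isomorphism $B\cong B'$ compatible with the maps from $A$ and to $C$. A realization $\mathfrak s$ assigns to each $\delta\in\mathbb E(C,A)$ an equivalence class $\mathfrak s(\delta)=[A\xrightarrow{x}B\xrightarrow{y}C]$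 such that for every morphism $(a,c):\delta\to\delta'$, with $\mathfrak s(\delta')=[A'\xrightarrow{x'}B'\xrightarrow{y'}C']$, there is $b:B\to B'$ with $bx=x'a$, $y'b=cy$ (one says $(a,b,c)$ realizes $(a,c)$). It is additive if $\mathfrak s(0)=[A\to A\oplus C\to C]$ (canonical maps) and $\mathfrak s(\delta\oplus\delta')=\mathfrak s(\delta)\oplus\mathfrak s(\delta')$. The triple $(\mathcal C,\mathbb E,\mathfrak s)$ is extriangulated if: (ET1) $\mathbb E$ is a biadditive functor. (ET2) $\mathfrak s$ is an additive realization. (ET3) If $\mathfrak s(\delta)=[A\xrightarrow{x}B\xrightarrow{y}C]$, $\mathfrak s(\delta')=[A'\xrightarrow{x'}B'\xrightarrow{y'}C']$ and $bx=x'a$, there is $c:C\to C'$ such that $(a,c):\delta\to\delta'$ is a morphism realized by $(a,b,c)$. (ET3)$^{\mathrm{op}}$: if $y'b=cy$, there is $a:A\to A'$ such that $(a,c):\delta\to\delta'$ is a morphism realized by $(a,b,c)$. (ET4) If $\delta\in\mathbb E(D,A)$, $\delta'\in\mathbb E(F,B)$ are realized by $A\xrightarrow{f}B\xrightarrow{f'}D$ and $B\xrightarrow{g}C\xrightarrow{g'}F$, there are an object $E$, morphisms $h=gf:A\to C$, $h':C\to E$, $d:D\to E$, $e:E\to F$ with $h'g=df'$, $eh'=g'$, and $\delta''\in\mathbb E(E,A)$ realized by $A\xrightarrow{h}C\xrightarrow{h'}E$, such that $D\xrightarrow{d}E\xrightarrow{e}F$ realizes $f'_*\delta'$, $d^*\delta''=\delta$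 and $f_*\delta''=e^*\delta'$. (ET4)$^{\mathrm{op}}$ If $\delta\in\mathbb E(B,D)$, $\delta'\in\mathbb E(C,F)$ are realized by $D\xrightarrow{f'}A\xrightarrow{f}B$ and $F\xrightarrow{g'}B\xrightarrow{g}C$, there are an object $E$, morphisms $d:D\to E$, $e:E\to F$, $h':E\to A$, $h=gf:A\to C$ with $h'd=f'$, $fh'=g'e$, and $\delta''\in\mathbb E(C,E)$ realized by $E\xrightarrow{h'}A\xrightarrow{h}C$, such that $D\xrightarrow{d}E\xrightarrow{e}F$ realizes $g'^*\delta$, $\delta'=e_*\delta''$ and $d_*\delta=g^*\delta''$. If $A\xrightarrow{x}B\xrightarrow{y}C$ realizes $\delta\in\mathbb E(C,A)$, the data $A\xrightarrow{x}B\xrightarrow{y}C\overset{\delta}{\dashrightarrow}$ is called an $\mathbb E$-triangle; it is split if $\delta=0$. In the $K$-linear setting the groups $\mathbb E(C,A)$ are $K$-vector spaces. An object $P$ is projective if for every $\mathbb E$-triangle $A\to B\xrightarrow{y}C\dashrightarrow$ every morphism $P\to C$ factors through $y$ (equivalently $\mathbb E(P,A)=0$ for all $A$); injective objects are defined dually. $\mathrm{Ind}(\mathcal C)$ is the set of isomorphism classes of indecomposable objects. $\mathcal C$ is locally finite if for every $A\in\mathrm{Ind}(\mathcal C)$ there are only finitely many $B\in\mathrm{Ind}(\mathcal C)$ with $\mathrm{Hom}_{\mathcal C}(A,B)\neq0$ and only finitely many $B\in\mathrm{Ind}(\mathcal C)$ with $\mathrm{Hom}_{\mathcal C}(B,A)\neq0$.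 A non-split $\delta\in\mathbb E(C,A)$ is almost split if $a_*\delta=0$ for every $a:A\to A'$ that is not a section (split monomorphism) and $c^*\delta=0$ for every $c:C'\to C$ that is not a retraction (split epimorphism). An $\mathbb E$-triangle realizing an almost split extension is an Auslander-Reiten $\mathbb E$-triangle. Grothendieck groups. Let $F$ be the free abelian group on the set of isomorphism classes $[X]$ of objects of $\mathcal C$. $K_0(\mathcal C,0)$ is the quotient of $F$ by the subgroup generated by all $[A]+[B]-[A\oplus B]$ (it is free abelian on $\mathrm{Ind}(\mathcal C)$). $K_0(\mathcal C)$ is the quotient of $K_0(\mathcal C,0)$ by the subgroup generated by all $[\delta]=[A]+[C]-[B]$ with $A\to B\to C\overset{\delta}{\dashrightarrow}$ an $\mathbb E$-triangle in $\mathcal C$. *)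

(* Defs.v *)
From HB Require Import structures.
From mathcomp Require Import all_boot all_algebra.
From mathcomp Require Import boolp classical_sets cardinality.
From mathcomp Require Import freeg.

Set Implicit Arguments.
Unset Strict Implicit.
Unset Printing Implicit Defensive.

Import GRing.Theory.
Local Open Scope ring_scope.
Local Open Scope classical_set_scope.
Local Open Scope quotient_scope.

Record linearCat (K : fieldType) := LinearCat {
  obj :> Type;
  Mor : obj -> obj -> lmodType K;
  idm : forall X, Mor X X;
  compm : forall X Y Z, Mor Y Z -> Mor X Y -> Mor X Z;
  compmA : forall X Y Z W (h : Mor Z W) (g : Mor Y Z) (f : Mor X Y),
    compm h (compm g f) = compm (compm h g) f;
  comp1m : forall X Y (f : Mor X Y), compm (idm Y) f = f;
  compm1 : forall X Y (f : Mor X Y), compm f (idm X) = f;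
  comp_linearl : forall X Y Z (k : K) (g g' : Mor Y Z) (f : Mor X Y),
    compm (k *: g + g') f = k *: compm g f + compm g' f;
  comp_linearr : forall X Y Z (k : K) (g : Mor Y Z) (f f' : Mor X Y),
    compm g (k *: f + f') = k *: compm g f + compm g f';
  zero_obj : obj;
  zero_objP : forall X,
    (forall f : Mor X zero_obj, f = 0) /\ (forall f : Mor zero_obj X, f = 0);
  dsum : obj -> obj -> obj;
  in1 : forall X Y, Mor X (dsum X Y);
  in2 : forall X Y, Mor Y (dsum X Y);
  pr1 : forall X Y, Mor (dsum X Y) X;
  pr2 : forall X Y, Mor (dsum X Y) Y;
  pr1_in1 : forall X Y, compm (pr1 X Y) (in1 X Y) = idm X;
  pr2_in2 : forall X Y, compm (pr2 X Y) (in2 X Y) = idm Y;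
  pr1_in2 : forall X Y, compm (pr1 X Y) (in2 X Y) = 0;
  pr2_in1 : forall X Y, compm (pr2 X Y) (in1 X Y) = 0;
  dsum_id : forall X Y,
    compm (in1 X Y) (pr1 X Y) + compm (in2 X Y) (pr2 X Y) = idm (dsum X Y)
}.

Arguments Mor {K l}.
Arguments idm {K l}.
Arguments compm {K l X Y Z}.
Arguments zero_obj {K}.
Arguments dsum {K l}.
Arguments in1 {K l}.
Arguments in2 {K l}.
Arguments pr1 {K l}.
Arguments pr2 {K l}.

Notation "g '\oc' f" := (compm g f) (at level 40, left associativity).
Notation "A '\+o' B" := (dsum A B) (at level 50, left associativity).

Section Category.
Variables (K : fieldType) (C : linearCat K).
Implicit Types A B X Y : C.

Definition isom X Y (f : Mor X Y) : Prop :=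
  exists g : Mor Y X, g \oc f = idm X /\ f \oc g = idm Y.

Definition isomorphic X Y : Prop := exists f : Mor X Y, isom f.

Definition split_mono X Y (f : Mor X Y) : Prop :=
  exists r : Mor Y X, r \oc f = idm X.

Definition split_epi X Y (f : Mor X Y) : Prop :=
  exists r : Mor Y X, f \oc r = idm Y.

Definition is_zero X : Prop := isomorphic X (zero_obj C).

Definition indecomposable X : Prop :=
  ~ is_zero X /\
  forall A B, isomorphic X (A \+o B) -> is_zero A \/ is_zero B.

Definition local_End X : Prop :=
  idm X <> 0 /\
  forall f g : Mor X X, ~ isom f -> ~ isom g -> ~ isom (f + g).

Definition is_direct_sum n (Y : 'I_n -> C) X : Prop :=
  exists (i : forall k, Mor (Y k) X) (p : forall k, Mor X (Y k)),
    [/\ forall k, p k \oc i k = idm (Y k),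
        forall k l, k != l -> p k \oc i l = 0
      & \sum_(k < n) i k \oc p k = idm X].

Definition krull_schmidt : Prop := forall X,
  exists (n : nat) (Y : 'I_n -> C),
    (forall k, local_End (Y k)) /\ is_direct_sum Y X.

Definition dsum_mor A B A' B' (f : Mor A A') (g : Mor B B') :
    Mor (A \+o B) (A' \+o B') :=
  in1 A' B' \oc f \oc pr1 A B + in2 A' B' \oc g \oc pr2 A B.

Lemma isomorphic_refl X : isomorphic X X.
Proof. by exists (idm X), (idm X); rewrite comp1m. Qed.

Lemma isomorphic_sym X Y : isomorphic X Y -> isomorphic Y X.
Proof. by move=> [f [g [gf fg]]]; exists g, f. Qed.

Lemma isomorphic_trans X Y Z :
  isomorphic X Y -> isomorphic Y Z -> isomorphic X Z.
Proof.
move=> [f [f' [f'f ff']]] [g [g' [g'g gg']]].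
exists (g \oc f), (f' \oc g'); split.
  by rewrite -compmA (compmA g') g'g comp1m.
by rewrite -compmA (compmA f) ff' comp1m.
Qed.

Definition isomorphicb : rel {classic C} := fun X Y => `[< isomorphic X Y >].

Lemma isomorphicb_refl : reflexive isomorphicb.
Proof. by move=> X; apply/asboolP/isomorphic_refl. Qed.

Lemma isomorphicb_sym : symmetric isomorphicb.
Proof. by move=> X Y; apply/asboolP/asboolP; apply: isomorphic_sym. Qed.

Lemma isomorphicb_trans : transitive isomorphicb.
Proof.
by move=> Y X Z /asboolP XY /asboolP YZ; apply/asboolP/(isomorphic_trans XY YZ).
Qed.

Canonical isomorphicb_equiv :=
  EquivRel isomorphicb isomorphicb_refl isomorphicb_sym isomorphicb_trans.

Definition iso_class : choiceType := {eq_quot isomorphicb}.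

Definition iso_class_of (X : C) : iso_class :=
  \pi_({eq_quot isomorphicb}) (X : {classic C}).

Definition locally_finite : Prop := forall A, indecomposable A ->
  finite_set [set iso_class_of B | B in
    [set B : C | indecomposable B /\ exists f : Mor A B, f <> 0]] /\
  finite_set [set iso_class_of B | B in
    [set B : C | indecomposable B /\ exists f : Mor B A, f <> 0]].

End Category.

Definition finite_dimensional (K : fieldType) (V : lmodType K) : Prop :=
  exists (n : nat) (e : 'I_n -> V),
    forall v : V, exists c : 'I_n -> K, v = \sum_(i < n) c i *: e i.

(* [emap c a] is E(c,a) : E(C,A) -> E(C',A') for c : C' -> C, a : A -> A'. *)
Record linearBifun (K : fieldType) (C : linearCat K) := LinearBifun {
  ext :> C -> C -> lmodType K;
  emap : forall X X' A A' : C,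
    Mor X' X -> Mor A A' -> ext X A -> ext X' A';
  emap_id : forall (X A : C) (d : ext X A), emap (idm X) (idm A) d = d;
  emap_comp : forall (X X' X'' A A' A'' : C) (c : Mor X' X) (c' : Mor X'' X')
      (a : Mor A A') (a' : Mor A' A'') (d : ext X A),
    emap (c \oc c') (a' \oc a) d = emap c' a' (emap c a d);
  emap_linear : forall (X X' A A' : C) (c : Mor X' X) (a : Mor A A') (k : K)
      (d d' : ext X A),
    emap c a (k *: d + d') = k *: emap c a d + emap c a d';
  emap_linearl : forall (X X' A A' : C) (k : K) (c c' : Mor X' X)
      (a : Mor A A') (d : ext X A),
    emap (k *: c + c') a d = k *: emap c a d + emap c' a d;
  emap_linearr : forall (X X' A A' : C) (c : Mor X' X) (k : K)
      (a a' : Mor A A') (d : ext X A),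
    emap c (k *: a + a') d = k *: emap c a d + emap c a' d
}.

Section Extriangulated.
Variables (K : fieldType) (C : linearCat K) (E : linearBifun C).

Definition push X A A' (a : Mor A A') (d : E X A) : E X A' :=
  emap (idm X) a d.

Definition pull X X' A (c : Mor X' X) (d : E X A) : E X' A :=
  emap c (idm A) d.

Definition ext_morphism X A X' A' (d : E X A) (d' : E X' A')
    (a : Mor A A') (c : Mor X X') : Prop :=
  push a d = pull c d'.

(* The element of E(X (+) X', A (+) A') with components (d, 0, 0, d'). *)
Definition ext_dsum X A X' A' (d : E X A) (d' : E X' A') :
    E (X \+o X') (A \+o A') :=
  emap (pr1 X X') (in1 A A') d + emap (pr2 X X') (in2 A A') d'.

Record sequence (A X : C) := Sequence {
  mid : C;
  infl : Mor A mid;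
  defl : Mor mid X
}.

Definition seq_equiv A X (S T : sequence A X) : Prop :=
  exists b : Mor (mid S) (mid T),
    [/\ isom b, b \oc infl S = infl T & defl T \oc b = defl S].

Definition seq_class A B X (x : Mor A B) (y : Mor B X) : set (sequence A X) :=
  [set T | seq_equiv (Sequence x y) T].

Variable s : forall X A, E X A -> set (sequence A X).

Definition realizes A B X (x : Mor A B) (y : Mor B X) (d : E X A) : Prop :=
  s d = seq_class x y.

Definition is_realization : Prop :=
  (forall X A (d : E X A), exists (B : C) (x : Mor A B) (y : Mor B X),
     realizes x y d) /\
  (forall A B X A' B' X' (d : E X A) (d' : E X' A')
     (x : Mor A B) (y : Mor B X) (x' : Mor A' B') (y' : Mor B' X')
     (a : Mor A A') (c : Mor X X'),
     realizes x y d -> realizes x' y' d' -> ext_morphism d d' a c ->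
     exists b : Mor B B', b \oc x = x' \oc a /\ y' \oc b = c \oc y).

Definition is_additive_realization : Prop :=
  [/\ is_realization,
      forall X A, realizes (in1 A X) (pr2 A X) (0 : E X A)
    & forall A B X A' B' X' (d : E X A) (d' : E X' A')
        (x : Mor A B) (y : Mor B X) (x' : Mor A' B') (y' : Mor B' X'),
        realizes x y d -> realizes x' y' d' ->
        realizes (dsum_mor x x') (dsum_mor y y') (ext_dsum d d')].

Definition ET3 : Prop :=
  forall A B X A' B' X' (d : E X A) (d' : E X' A')
    (x : Mor A B) (y : Mor B X) (x' : Mor A' B') (y' : Mor B' X')
    (a : Mor A A') (b : Mor B B'),
    realizes x y d -> realizes x' y' d' -> b \oc x = x' \oc a ->
    exists c : Mor X X', ext_morphism d d' a c /\ y' \oc b = c \oc y.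

Definition ET3op : Prop :=
  forall A B X A' B' X' (d : E X A) (d' : E X' A')
    (x : Mor A B) (y : Mor B X) (x' : Mor A' B') (y' : Mor B' X')
    (b : Mor B B') (c : Mor X X'),
    realizes x y d -> realizes x' y' d' -> y' \oc b = c \oc y ->
    exists a : Mor A A', ext_morphism d d' a c /\ b \oc x = x' \oc a.

Definition ET4 : Prop :=
  forall (A B D X F : C) (d1 : E D A) (d2 : E F B)
    (f : Mor A B) (f' : Mor B D) (g : Mor B X) (g' : Mor X F),
    realizes f f' d1 -> realizes g g' d2 ->
    exists (M : C) (h' : Mor X M) (d : Mor D M) (e : Mor M F) (d3 : E M A),
      [/\ h' \oc g = d \oc f' /\ e \oc h' = g',
          realizes (g \oc f) h' d3,
          realizes d e (push f' d2),
          pull d d3 = d1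
        & push f d3 = pull e d2].

Definition ET4op : Prop :=
  forall (A B D X F : C) (d1 : E B D) (d2 : E X F)
    (f' : Mor D A) (f : Mor A B) (g' : Mor F B) (g : Mor B X),
    realizes f' f d1 -> realizes g' g d2 ->
    exists (M : C) (d : Mor D M) (e : Mor M F) (h' : Mor M A) (d3 : E X M),
      [/\ h' \oc d = f' /\ f \oc h' = g' \oc e,
          realizes h' (g \oc f) d3,
          realizes d e (pull g' d1),
          d2 = push e d3
        & push d d1 = pull g d3].

Definition is_extriangulated : Prop :=
  [/\ is_additive_realization, ET3, ET3op, ET4 & ET4op].

Definition projective_obj P : Prop :=
  forall A B X (x : Mor A B) (y : Mor B X) (d : E X A), realizes x y d ->
  forall f : Mor P X, exists g : Mor P B, y \oc g = f.

Definition injective_obj I : Prop :=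
  forall A B X (x : Mor A B) (y : Mor B X) (d : E X A), realizes x y d ->
  forall f : Mor A I, exists g : Mor B I, g \oc x = f.

Definition almost_split X A (d : E X A) : Prop :=
  [/\ d <> 0,
      forall A' (a : Mor A A'), ~ split_mono a -> push a d = 0
    & forall X' (c : Mor X' X), ~ split_epi c -> pull c d = 0].

End Extriangulated.

Section SubgroupGeneratedBy.
Variables (V : zmodType) (S : set V).

Definition zspan : {pred V} := fun v =>
  `[< forall H : {pred V}, zmod_closed H -> (forall u, S u -> u \in H) ->
      v \in H >].

Lemma zspan_zmod_closed : zmod_closed zspan.
Proof.
split=> [|u v /asboolP uS /asboolP vS]; apply/asboolP => H Hz SH.
  by case: Hz.
by case: (Hz) => _; apply; [apply: uS | apply: vS].
Qed.

HB.instance Definition _ := GRing.isZmodClosed.Build V zspan zspan_zmod_closed.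

Definition zmod_quot : zmodType := Quotient.quot zspan.

Definition zmod_proj (v : V) : zmod_quot := \pi_(Quotient.quot zspan) v.

Lemma zmod_proj_is_zmod_morphism : zmod_morphism zmod_proj.
Proof. by move=> u v; rewrite /zmod_proj raddfB. Qed.

HB.instance Definition _ :=
  GRing.isZmodMorphism.Build V zmod_quot zmod_proj zmod_proj_is_zmod_morphism.

End SubgroupGeneratedBy.

Section Grothendieck.
Variables (K : fieldType) (C : linearCat K).

Definition free_iso : zmodType := {freeg (iso_class C) / int}.

Definition free_class (X : C) : free_iso := << iso_class_of X >>.

Definition K0_split : zmodType :=
  zmod_quot [set v : free_iso | exists A B : C,
    v = free_class A + free_class B - free_class (A \+o B)].

Definition class0 (X : C) : K0_split := zmod_proj _ (free_class X).

Variables (E : linearBifun C) (s : forall X A, E X A -> set (sequence A X)).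

Definition triangle_classes : set K0_split :=
  [set v | exists (A B X : C) (x : Mor A B) (y : Mor B X) (d : E X A),
    realizes s x y d /\ v = class0 A + class0 X - class0 B].

Definition AR_triangle_classes : set K0_split :=
  [set v | exists (A B X : C) (x : Mor A B) (y : Mor B X) (d : E X A),
    [/\ realizes s x y d, almost_split d &
        v = class0 A + class0 X - class0 B]].

Definition K0 : zmodType := zmod_quot triangle_classes.

Definition K0_proj : {additive K0_split -> K0} :=
  @zmod_proj K0_split triangle_classes.

End Grothendieck.

(* Main.v *)
(* Every nonsplit extension d in E(X, A) can be stripped of an almost split one.
   Local finiteness and finite dimensionality give c : Y -> X, Y local, such
   that e = c^* d is nonzero but is killed by pullback along non-retractions;
   dually some a : A -> W makes a_* e almost split. By (ET4)^op, if e is realized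
   by A -i-> M -> Y then i_* d is realized by M -> B (+) Y -> X, so that
   [d] = [e] + [i_* d]. By (ET4), if a_* e is realized by W -> N -p-> Y then p^* e
   is realized by A -> M (+) W -> N; as p is not a retraction p^* e = 0, whence
   [e] = [a_* e]. The process stops: i_* d kills all that d does, and also c, so
   the annihilator of d in Hom(G, X), where the indecomposables mapping nontrivially
   to X are summands of G, strictly increases. *)
Require Import Defs.
From mathcomp Require Import all_boot all_algebra.
From mathcomp Require Import boolp classical_sets cardinality.

Set Implicit Arguments.
Unset Strict Implicit.
Unset Printing Implicit Defensive.

Import GRing.Theory.
Local Open Scope ring_scope.
Local Open Scope classical_set_scope.
Local Open Scope quotient_scope.

(** * Linear categories: biproduct calculus, local objects, and covers by a single object *)

Section LinearCategories.
Variables (K : fieldType) (C : linearCat K).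
Implicit Types A B X Y Z : C.

Lemma compDl X Y Z (g g' : Mor Y Z) (f : Mor X Y) :
  (g + g') \oc f = g \oc f + g' \oc f.
Proof. by have := comp_linearl 1 g g' f; rewrite !scale1r. Qed.

Lemma compDr X Y Z (g : Mor Y Z) (f f' : Mor X Y) :
  g \oc (f + f') = g \oc f + g \oc f'.
Proof. by have := comp_linearr 1 g f f'; rewrite !scale1r. Qed.

Lemma comp0l X Y Z (f : Mor X Y) : (0 : Mor Y Z) \oc f = 0.
Proof. by apply: (addrI (0 \oc f)); rewrite -compDl !addr0. Qed.

Lemma comp0r X Y Z (g : Mor Y Z) : g \oc (0 : Mor X Y) = 0.
Proof. by apply: (addrI (g \oc 0)); rewrite -compDr !addr0. Qed.

Lemma compNl X Y Z (g : Mor Y Z) (f : Mor X Y) : (- g) \oc f = - (g \oc f).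
Proof. by apply: (addrI (g \oc f)); rewrite -compDl !subrr comp0l. Qed.

Lemma compNr X Y Z (g : Mor Y Z) (f : Mor X Y) : g \oc (- f) = - (g \oc f).
Proof. by apply: (addrI (g \oc f)); rewrite -compDr !subrr comp0r. Qed.

Lemma comp_suml X Y Z n (g : 'I_n -> Mor Y Z) (f : Mor X Y) :
  (\sum_i g i) \oc f = \sum_i g i \oc f.
Proof.
exact: (big_morph (fun h => h \oc f) (fun g g' => compDl g g' f) (comp0l _ f)).
Qed.

Lemma comp_sumr X Y Z n (g : Mor Y Z) (f : 'I_n -> Mor X Y) :
  g \oc (\sum_i f i) = \sum_i g \oc f i.
Proof. exact: (big_morph _ (compDr g) (comp0r _ g)). Qed.

Lemma in1K X Y Z (h : Mor X Z) : h \oc pr1 X Y \oc in1 X Y = h.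
Proof. by rewrite -compmA pr1_in1 compm1. Qed.

Lemma in2K X Y Z (h : Mor Y Z) : h \oc pr2 X Y \oc in2 X Y = h.
Proof. by rewrite -compmA pr2_in2 compm1. Qed.

Lemma comp_pr1_in2 X Y Z (h : Mor X Z) : h \oc pr1 X Y \oc in2 X Y = 0.
Proof. by rewrite -compmA pr1_in2 comp0r. Qed.

Lemma comp_pr2_in1 X Y Z (h : Mor Y Z) : h \oc pr2 X Y \oc in1 X Y = 0.
Proof. by rewrite -compmA pr2_in1 comp0r. Qed.

(** Oriented to expand sums and to associate composites to the left; this left-associated form is
    why the rules [in1K] to [comp_pr2_in1] carry an extra factor [h]. *)
Definition dsumE := (compDl, compDr, compNl, compNr, compmA, in1K, in2K,
  comp_pr1_in2, comp_pr2_in1, pr1_in1, pr2_in2, pr1_in2, pr2_in1,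
  comp1m, compm1, comp0l, comp0r, addr0, add0r, subr0).

Lemma comp_dsum_id X Y Z (h : Mor (X \+o Y) Z) :
  h \oc in1 X Y \oc pr1 X Y + h \oc in2 X Y \oc pr2 X Y = h.
Proof. by rewrite -!compmA -compDr dsum_id compm1. Qed.

Lemma isom_id X : isom (idm X).
Proof. by exists (idm X); rewrite comp1m. Qed.

Lemma isom_two_sided X Y (f : Mor X Y) (g h : Mor Y X) :
  g \oc f = idm X -> f \oc h = idm Y -> isom f.
Proof.
move=> gf fh; exists g; split => //.
suff -> : g = h by [].
by rewrite -[g]compm1 -fh compmA gf comp1m.
Qed.

Lemma isom_of_comps X Y (f : Mor X Y) (g : Mor Y X) :
  isom (g \oc f) -> isom (f \oc g) -> isom f.
Proof.
move=> [u [ugf _]] [v [_ fgv]].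
by apply: (@isom_two_sided _ _ _ (u \oc g) (g \oc v)); rewrite -?compmA // compmA.
Qed.

Lemma isom_id_add_square0 X (n : Mor X X) : n \oc n = 0 -> isom (idm X + n).
Proof.
by move=> nn; exists (idm X - n); rewrite !dsumE nn !(addr0, oppr0, addrK, subrK, subr0).
Qed.

Lemma is_zero_id0 X : idm X = 0 -> is_zero X.
Proof.
move=> id0; exists 0, 0; split; first by rewrite comp0l id0.
by rewrite comp0l (proj1 (zero_objP (zero_obj C)) (idm _)).
Qed.

Lemma id0_is_zero X : is_zero X -> idm X = 0.
Proof.
move=> [f [g [gf _]]].
by rewrite -gf (proj1 (zero_objP X) f) comp0r.
Qed.

(** Links [krull_schmidt], phrased with local endomorphism rings, to [locally_finite], phrased with
    indecomposables. A decomposition writes [idm X] as [e1 + e2]; one of these is invertible, and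
    the projection onto the other summand, which kills it, must vanish. *)
Lemma local_End_indecomposable X : local_End X -> indecomposable X.
Proof.
move=> [idX locX]; split=> [/id0_is_zero //|A B [f [g [gf fg]]]].
set e1 := g \oc in1 A B \oc pr1 A B \oc f.
set e2 := g \oc in2 A B \oc pr2 A B \oc f.
have e12 : e1 + e2 = idm X.
  by rewrite /e1 /e2 -compDl comp_dsum_id.
have [[u [_ e1u]]|e1N] := pselect (isom e1).
  right; apply: is_zero_id0.
  have e20 : pr2 A B \oc f = 0.
    rewrite -[_ \oc f]compm1 -e1u compmA /e1 !compmA.
    by rewrite -(compmA (pr2 A B)) fg compm1 pr2_in1 !comp0l.
  by rewrite -(pr2_in2 A B) -[pr2 A B]compm1 -fg compmA e20 !comp0l.
have [[u [_ e2u]]|e2N] := pselect (isom e2).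
  left; apply: is_zero_id0.
  have e10 : pr1 A B \oc f = 0.
    rewrite -[_ \oc f]compm1 -e2u compmA /e2 !compmA.
    by rewrite -(compmA (pr1 A B)) fg compm1 pr1_in2 !comp0l.
  by rewrite -(pr1_in1 A B) -[pr1 A B]compm1 -fg compmA e10 !comp0l.
by case: (locX _ _ e1N e2N); rewrite e12; apply: isom_id.
Qed.

Lemma local_End_id_sub X (f : Mor X X) : local_End X -> ~ isom f -> isom (idm X - f).
Proof.
move=> [_ locX] fN; apply: contrapT => gN.
by apply: (locX _ _ fN gN); rewrite addrC subrK; apply: isom_id.
Qed.

Definition retract Z X : Prop := exists (i : Mor Z X) (p : Mor X Z), p \oc i = idm Z.

Lemma retract_trans X Y Z : retract X Y -> retract Y Z -> retract X Z.
Proof.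
move=> [i [p pi]] [j [q qj]]; exists (j \oc i), (p \oc q).
by rewrite -compmA (compmA q) qj comp1m.
Qed.

Lemma iso_class_of_eq X Y : iso_class_of X = iso_class_of Y <-> isomorphic X Y.
Proof.
split=> [/eqP|XY]; first by rewrite eqmodE => /asboolP.
by apply/eqP; rewrite eqmodE; apply/asboolP.
Qed.

(** [G] is the direct sum of one representative [repr c] per class, so a single object stands for a
    finite list of classes. *)
Lemma finite_iso_classes_retract (P : set C) :
  finite_set [set iso_class_of B | B in P] ->
  exists G, forall Z, P Z -> retract Z G.
Proof.
move/finite_seqP => [cs csP].
suff [G GP] : exists G, forall Z, iso_class_of Z \in cs -> retract Z G.
  exists G => Z PZ; apply: GP.
  have : [set` cs] (iso_class_of Z) by rewrite -csP; exists Z.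
  by [].
elim: cs {csP} => [|c cs [G GP]]; first by exists (zero_obj C).
exists ((repr c : C) \+o G) => Z; rewrite inE => /orP[/eqP cZ|/GP ZG].
  have [f [g [gf _]]] : isomorphic Z (repr c : C).
    by apply/iso_class_of_eq; rewrite cZ [RHS]/iso_class_of reprK.
  by exists (in1 _ _ \oc f), (g \oc pr1 _ _); rewrite !dsumE.
apply: retract_trans ZG _.
by exists (in2 _ _), (pr2 _ _); rewrite pr2_in2.
Qed.

Lemma retract_family n (Y : 'I_n -> C) :
  exists G, forall k, retract (Y k) G.
Proof.
elim: n Y => [|n IHn] Y; first by exists (zero_obj C) => -[].
have [G GP] := IHn (fun k => Y (lift ord0 k)).
exists (Y ord0 \+o G) => k.
case: (unliftP ord0 k) => [j ->|->]; last first.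
  by exists (in1 _ _), (pr1 _ _); rewrite pr1_in1.
apply: retract_trans (GP j) _.
by exists (in2 _ _), (pr2 _ _); rewrite pr2_in2.
Qed.

Hypotheses (KS : krull_schmidt C) (lfC : locally_finite C).

(** A nonzero map into [X] has a nonzero component in some local summand [Y k]. Local finiteness at
    [Y k] makes its source a retract of some [H k], and [G] collects the finitely many [H k]. *)
Lemma finite_source_cover X :
  exists G, forall Z, local_End Z -> forall f : Mor Z X, f <> 0 -> retract Z G.
Proof.
have [n [Y [locY [i [p [_ _ sum_ip]]]]]] := KS X.
have /choice[H HP] : forall k, exists H, forall Z, local_End Z ->
    forall f : Mor Z (Y k), f <> 0 -> retract Z H.
  move=> k; have [_ fin] := lfC (local_End_indecomposable (locY k)).
  have [H HP] := finite_iso_classes_retract fin.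
  exists H => Z locZ f f0; apply: HP; split; last by exists f.
  exact: local_End_indecomposable.
have [G GP] := retract_family H.
exists G => Z locZ f f0.
have [/existsNP[k pf0]|allN] := pselect (~ forall k, p k \oc f = 0).
  exact: retract_trans (HP k Z locZ _ pf0) (GP k).
move/contrapT: allN => all0; case: f0.
rewrite -[f]comp1m -sum_ip comp_suml big1 // => k _.
by rewrite -compmA all0 comp0r.
Qed.

(** The dual argument, with the components [f \oc i k] of a map out of [X]. *)
Lemma finite_target_cover X :
  exists G, forall Z, local_End Z -> forall f : Mor X Z, f <> 0 -> retract Z G.
Proof.
have [n [Y [locY [i [p [_ _ sum_ip]]]]]] := KS X.
have /choice[H HP] : forall k, exists H, forall Z, local_End Z ->
    forall f : Mor (Y k) Z, f <> 0 -> retract Z H.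
  move=> k; have [fin _] := lfC (local_End_indecomposable (locY k)).
  have [H HP] := finite_iso_classes_retract fin.
  exists H => Z locZ f f0; apply: HP; split; last by exists f.
  exact: local_End_indecomposable.
have [G GP] := retract_family H.
exists G => Z locZ f f0.
have [/existsNP[k fi0]|allN] := pselect (~ forall k, f \oc i k = 0).
  exact: retract_trans (HP k Z locZ _ fi0) (GP k).
move/contrapT: allN => all0; case: f0.
rewrite -[f]compm1 -sum_ip comp_sumr big1 // => k _.
by rewrite compmA all0 comp0l.
Qed.

End LinearCategories.

(** * A strictly monotone rank on the subspaces of a finite dimensional space *)

Definition subspace (K : fieldType) (V : lmodType K) (S : set V) : Prop :=
  S 0 /\ forall (k : K) u v, S u -> S v -> S (k *: u + v).

(* The rank of [S] is the dimension of its preimage under [K^n ->> V]. *)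
Lemma finite_dimensional_rank (K : fieldType) (V : lmodType K) :
  finite_dimensional V ->
  exists (n : nat) (mu : set V -> nat), (forall S, mu S <= n)%N /\
    forall S T, subspace S -> subspace T -> S `<=` T -> ~ T `<=` S ->
    (mu S < mu T)%N.
Proof.
move=> [n [e eP]]; exists n.
pose phi (r : 'rV[K]_n) := \sum_(i < n) r 0 i *: e i.
have phi0 : phi 0 = 0 by rewrite /phi big1 // => i _; rewrite mxE scale0r.
have phiD k r r' : phi (k *: r + r') = k *: phi r + phi r'.
  rewrite /phi scaler_sumr -big_split /=; apply: eq_bigr => i _.
  by rewrite !mxE scalerDl scalerA.
(* Subspaces of [K^n] are encoded as row spaces of square matrices; [mu S] will be the largest rank
   of a matrix whose row space [phi] maps into [S]. *)
pose fits S (M : 'M[K]_n) := forall r, (r <= M)%MS -> S (phi r).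
pose P S := [pred r : 'I_n.+1 | `[< exists2 M, fits S M & \rank M = r >] ].
pose mu S := \max_(r in P S) (r : nat).
exists mu; split=> [S|S T [S0 _] [_ TD] ST].
  by apply/bigmax_leqP => i _; rewrite -ltnS.
move=> /existsNP[v /not_implyP[Tv Sv]].
have [M fitM rkM] : exists2 M, fits S M & \rank M = mu S.
  have PS0 : (0 < #|P S|)%N.
    apply/card_gt0P; exists ord0; apply/asboolP; exists 0; last by rewrite mxrank0.
    by move=> r; rewrite submx0 => /eqP ->; rewrite phi0.
  rewrite /mu; have [r /asboolP[M fitM rkM] ->] := eq_bigmax_cond (@nat_of_ord n.+1) PS0.
  by exists M.
have [c vE] := eP v.
(* A row [w] over a vector of [T] outside [S] is not in the row space of [M]; adjoining it raises
   the rank, and the sum still fits [T]. *)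
pose w : 'rV[K]_n := \row_i c i.
have phiw : phi w = v by rewrite vE; apply: eq_bigr => i _; rewrite mxE.
have wM : ~~ (w <= M)%MS by apply/negP => /fitM; rewrite phiw.
have rk_lt : (\rank M < \rank (M + w)%MS)%N.
  rewrite ltn_neqAle mxrankS ?addsmxSl // andbT; apply/negP => /eqP rkE.
  have := mxrank_leqif_sup (addsmxSl M w); rewrite rkE => -[_ /esym].
  by rewrite eqxx addsmx_sub submx_refl (negPf wM).
rewrite -rkM; apply: leq_trans rk_lt _.
have lt_n : (\rank (M + w)%MS < n.+1)%N by rewrite ltnS rank_leq_col.
apply: (@leq_bigmax_cond _ (P T) (@nat_of_ord n.+1) (Ordinal lt_n)).
apply/asboolP; exists (M + w)%MS => // r /sub_addsmxP[[u u'] /= ->].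
have /sub_rVP[k ->] : (u' *m w <= w)%MS by rewrite submxMl.
rewrite addrC phiD phiw; apply: TD => //; apply/ST/fitM; exact: submxMl.
Qed.

(** * Elements of a contravariant functor that are killed by all non-retractions *)

Section SocleElement.
Variables (K : fieldType) (C : linearCat K) (M : C -> lmodType K).
(** A contravariant action, linear in the morphism. It will be pullback on [E(-, A)] and, over the
    opposite category, pushout on [E(Y, -)]. *)
Variable act : forall Z Z' : C, Mor Z' Z -> M Z -> M Z'.
Hypotheses
  (act_id : forall Z (m : M Z), act (idm Z) m = m)
  (act_comp : forall Z Z' Z'' (f : Mor Z' Z) (g : Mor Z'' Z') (m : M Z),
    act (f \oc g) m = act g (act f m))
  (act_linear : forall Z Z' (k : K) (f g : Mor Z' Z) (m : M Z),
    act (k *: f + g) m = k *: act f m + act g m).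

Let act0 Z Z' (m : M Z) : act (0 : Mor Z' Z) m = 0.
Proof.
have := act_linear 1 (0 : Mor Z' Z) 0 m.
by rewrite scaler0 add0r scale1r => /esym/(canRL (addrK _)); rewrite subrr.
Qed.

Let actB Z Z' (f g : Mor Z' Z) (m : M Z) : act (f - g) m = act f m - act g m.
Proof. by rewrite addrC -scaleN1r act_linear scaleN1r addrC. Qed.

Let act_r0 Z Z' (f : Mor Z' Z) : act f 0 = 0.
Proof. by rewrite -(act0 Z (0 : M Z)) -act_comp comp0l act0. Qed.

Let act_sum Z Z' n (f : 'I_n -> Mor Z' Z) (m : M Z) :
  act (\sum_i f i) m = \sum_i act (f i) m.
Proof.
apply: (big_morph (fun f => act f m)) => [g h|]; last exact: act0.
by have := act_linear 1 g h m; rewrite !scale1r.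
Qed.

(** Over a decomposition of [Z] into local summands, [m] is the sum of the elements
    [act (p k) (act (i k) m)], so they cannot all vanish. *)
Let nonzero_on_local (KS : krull_schmidt C) Z (m : M Z) : m <> 0 ->
  exists Y (i : Mor Y Z), local_End Y /\ act i m <> 0.
Proof.
move=> m0; have [n [Y [locY [i [p [_ _ sum_ip]]]]]] := KS Z.
apply: contrapT => none; apply: m0.
rewrite -(act_id m) -sum_ip act_sum big1 // => k _.
rewrite act_comp; have [->|im0] := pselect (act (i k) m = 0); first exact: act_r0.
by case: none; exists (Y k), (i k).
Qed.

(* The subspaces [act (c \oc u) d], [u : Mor G Y], of the finite dimensional
   [M G] strictly decrease when [c] is composed with a non-retraction: by
   locality of [Y], equality would give an automorphism [w] of [Y] with
   [act (c \oc w) d = 0]. *)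
Lemma socle_element (KS : krull_schmidt C) X (d : M X) G :
    finite_dimensional (M G) ->
    (forall Z, local_End Z -> forall f : Mor Z X, f <> 0 -> retract Z G) ->
    d <> 0 ->
  exists Y (c : Mor Y X), [/\ local_End Y, act c d <> 0 &
    forall Z (t : Mor Z Y), ~ split_epi t -> act t (act c d) = 0].
Proof.
move=> /finite_dimensional_rank[n [mu [_ muP]]] coverG d0.
pose D Y (c : Mor Y X) : set (M G) := [set act (c \oc u) d | u in setT].
have subD Y (c : Mor Y X) : subspace (D Y c).
  split; first by exists 0; rewrite // comp0r act0.
  move=> k _ _ [u _ <-] [v _ <-]; exists (k *: u + v) => //.
  by rewrite comp_linearr act_linear.
suff step N Y (c : Mor Y X) : local_End Y -> act c d <> 0 -> (mu (D Y c) < N)%N ->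
    exists Y (c : Mor Y X), [/\ local_End Y, act c d <> 0 &
      forall Z (t : Mor Z Y), ~ split_epi t -> act t (act c d) = 0].
  have [Y [c [locY cd0]]] := nonzero_on_local KS d0.
  exact: step locY cd0 (ltnSn _).
elim: N Y c => // N IHN Y c locY cd0; rewrite ltnS => muN.
have [small|big] := pselect
  (forall Z (t : Mor Z Y), ~ split_epi t -> act t (act c d) = 0).
  by exists Y, c.
have [Z [t [tN td0]]] : exists Z (t : Mor Z Y), ~ split_epi t /\ act t (act c d) <> 0.
  apply: contrapT => none; apply: big => Z t tN; apply: contrapT => td0.
  by apply: none; exists Z, t.
have [W [i [locW id0]]] := nonzero_on_local KS td0.
(* Passing from [Z] to the local object [W] keeps the source of the new morphism local. *)
apply: (IHN W (c \oc (t \oc i))) => //; first by rewrite !act_comp.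
apply: leq_trans muN; apply: muP => // [_ [u _ <-]|DcD].
  by exists (t \oc i \oc u); rewrite // !compmA.
have c0 : c <> 0 by move=> c0; apply: cd0; rewrite c0 act0.
have [j [p pj]] := coverG _ locY _ c0.
have [|u _ cpE] := DcD (act (c \oc p) d); first by exists p.
(* [r] factors through the non-retraction [t], so it is not invertible; restricting [cpE] along [j]
   gives [act c d = act (c \oc r) d]. *)
pose r := t \oc i \oc u \oc j.
have rN : ~ isom r.
  move=> [v [_ rv]]; apply: tN; exists (i \oc u \oc j \oc v).
  by rewrite -rv !compmA.
have [v [_ wv]] := local_End_id_sub locY rN.
apply: cd0; rewrite -[c]compm1 -wv compmA act_comp.
suff -> : act (c \oc (idm Y - r)) d = 0 by exact: act_r0.
rewrite compDr compNr compm1 actB /r !compmA [X in _ - X]act_comp.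
rewrite -[in X in X - _](compm1 c) -pj compmA [X in X - _]act_comp -cpE.
by rewrite !compmA subrr.
Qed.

End SocleElement.

(** * The opposite category, in which pushouts play the part of pullbacks *)

Definition op_cat (K : fieldType) (C : linearCat K) : linearCat K.
Proof.
refine (@LinearCat K C (fun X Y => Mor Y X) (fun X => idm X)
  (fun X Y Z g f => f \oc g) _ _ _ _ _ (zero_obj C) _ (fun X Y => X \+o Y)
  (fun X Y => pr1 X Y) (fun X Y => pr2 X Y)
  (fun X Y => in1 X Y) (fun X Y => in2 X Y) _ _ _ _ _).
- by move=> *; rewrite compmA.
- by move=> *; rewrite compm1.
- by move=> *; rewrite comp1m.
- by move=> *; rewrite comp_linearr.
- by move=> *; rewrite comp_linearl.
- by move=> X; case: (zero_objP X).
- exact: pr1_in1.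
- exact: pr2_in2.
- exact: pr2_in1.
- exact: pr1_in2.
- exact: dsum_id.
(* Left transparent, so that morphisms and composites of [op_cat C] convert to reversed ones of
   [C]. *)
Defined.

Section Opposite.
Variables (K : fieldType) (C : linearCat K).

Lemma isom_op (X Y : C) (f : Mor X Y) : isom (f : Mor (Y : op_cat C) X) <-> isom f.
Proof. by split=> -[g [gf fg]]; exists g. Qed.

Lemma local_End_op (X : C) : local_End (X : op_cat C) <-> local_End X.
Proof.
by split=> -[idX loc]; split=> // f g fN gN /isom_op fgI; apply: (loc f g) => // /isom_op.
Qed.

Lemma krull_schmidt_op : krull_schmidt C -> krull_schmidt (op_cat C).
Proof.
move=> KS X; have [n [Y [locY [i [p [pi pi0 ip]]]]]] := KS X.
exists n, Y; split; first by move=> k; apply/local_End_op.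
exists p, i; split=> // k l kl; by apply: pi0; rewrite eq_sym.
Qed.

End Opposite.

(** * Consequences of the axioms for E-triangles *)

Section Extriangulated.
Variables (K : fieldType) (C : linearCat K) (E : linearBifun C).
Implicit Types A B X Y Z : C.

Lemma emapD X X' A A' (c : Mor X' X) (a : Mor A A') (d d' : E X A) :
  emap c a (d + d') = emap c a d + emap c a d'.
Proof. by have := emap_linear c a 1 d d'; rewrite !scale1r. Qed.

Lemma emap0 X X' A A' (c : Mor X' X) (a : Mor A A') : emap c a (0 : E X A) = 0.
Proof. by apply: (addrI (emap c a 0)); rewrite -emapD !addr0. Qed.

Lemma emap0l X X' A A' (a : Mor A A') (d : E X A) : emap (0 : Mor X' X) a d = 0.
Proof.
have := emap_linearl 1 (0 : Mor X' X) 0 a d.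
by rewrite scaler0 add0r scale1r => /esym/(canRL (addrK _)); rewrite subrr.
Qed.

Lemma push_emap X X' A A' A'' (c : Mor X' X) (a : Mor A A') (a' : Mor A' A'')
  (d : E X A) : push a' (emap c a d) = emap c (a' \oc a) d.
Proof. by rewrite /push -emap_comp compm1. Qed.

Lemma pull_emap X X' X'' A A' (c : Mor X' X) (c' : Mor X'' X') (a : Mor A A')
  (d : E X A) : pull c' (emap c a d) = emap (c \oc c') a d.
Proof. by rewrite /pull -emap_comp comp1m. Qed.

Lemma push_push X A A' A'' (a : Mor A A') (a' : Mor A' A'') (d : E X A) :
  push a' (push a d) = push (a' \oc a) d.
Proof. exact: push_emap. Qed.

Lemma pull_pull X X' X'' A (c : Mor X' X) (c' : Mor X'' X') (d : E X A) :
  pull c' (pull c d) = pull (c \oc c') d.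
Proof. exact: pull_emap. Qed.

Lemma push_pull X X' A A' (c : Mor X' X) (a : Mor A A') (d : E X A) :
  push a (pull c d) = pull c (push a d).
Proof. by rewrite push_emap pull_emap compm1 comp1m. Qed.

Variable s : forall X A, E X A -> set (sequence A X).
Hypothesis ETs : is_extriangulated s.

Lemma seq_equiv_refl A X (S : sequence A X) : seq_equiv S S.
Proof. by exists (idm _); rewrite comp1m compm1; split=> //; apply: isom_id. Qed.

Lemma seq_equiv_trans A X (S T U : sequence A X) :
  seq_equiv S T -> seq_equiv T U -> seq_equiv S U.
Proof.
move=> [b [[b' [b'b bb']] bx yb]] [c [[c' [c'c cc']] cx yc]]; exists (c \oc b).
split; rewrite -?compmA ?bx // ?compmA ?yc //.
exists (b' \oc c'); rewrite !compmA -(compmA b') c'c compm1.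
by rewrite -(compmA c) bb' compm1.
Qed.

Lemma seq_equiv_sym A X (S T : sequence A X) : seq_equiv S T -> seq_equiv T S.
Proof.
move=> [b [[b' [b'b bb']] bx yb]]; exists b'; split; first by exists b.
  by rewrite -bx compmA b'b comp1m.
by rewrite -yb -compmA bb' compm1.
Qed.

Lemma realizes_equiv A B X B' (x : Mor A B) (y : Mor B X) (x' : Mor A B')
    (y' : Mor B' X) (d : E X A) (b : Mor B B') :
  realizes s x y d -> isom b -> b \oc x = x' -> y' \oc b = y ->
  realizes s x' y' d.
Proof.
move=> sd bI bx yb; rewrite /realizes sd.
have xx' : seq_equiv (Sequence x y) (Sequence x' y') by exists b.
apply/predeqP => S; split; last exact: seq_equiv_trans.
exact: seq_equiv_trans (seq_equiv_sym xx').
Qed.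

Lemma realizes_mid_isomorphic A B X B' (x : Mor A B) (y : Mor B X)
    (x' : Mor A B') (y' : Mor B' X) (d : E X A) :
  realizes s x y d -> realizes s x' y' d -> isomorphic B B'.
Proof.
rewrite /realizes => -> e.
have : seq_class x' y' (Sequence x' y') by apply: seq_equiv_refl.
by rewrite -e => -[b [bI _ _]]; exists b.
Qed.

Lemma realizes_ex X A (d : E X A) :
  exists B (x : Mor A B) (y : Mor B X), realizes s x y d.
Proof. by case: ETs => -[[]]. Qed.

Lemma realizes_mor A B X A' B' X' (d : E X A) (d' : E X' A')
    (x : Mor A B) (y : Mor B X) (x' : Mor A' B') (y' : Mor B' X')
    (a : Mor A A') (c : Mor X X') :
  realizes s x y d -> realizes s x' y' d' -> ext_morphism d d' a c ->
  exists b : Mor B B', b \oc x = x' \oc a /\ y' \oc b = c \oc y.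
Proof. by case: ETs => -[[]] _ + _ _ _ _ _ _ => H; apply: H. Qed.

Lemma realizes_split A X : realizes s (in1 A X) (pr2 A X) (0 : E X A).
Proof. by case: ETs => -[]. Qed.

Lemma realizes_dsum A B X A' B' X' (d : E X A) (d' : E X' A')
    (x : Mor A B) (y : Mor B X) (x' : Mor A' B') (y' : Mor B' X') :
  realizes s x y d -> realizes s x' y' d' ->
  realizes s (dsum_mor x x') (dsum_mor y y') (ext_dsum d d').
Proof. by case: ETs => -[] _ _ + _ _ _ _ => H; apply: H. Qed.

Lemma realizes_ET3 : ET3 s. Proof. by case: ETs. Qed.
Lemma realizes_ET3op : ET3op s. Proof. by case: ETs. Qed.

(** This triangle and its dual [realizes_0id] are test objects: comparing a triangle with them by
    (ET3) and its dual gives weak exactness, and adding them to a triangle enlarges two adjacent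
    terms. *)
Lemma realizes_id0 A : realizes s (idm A) 0 (0 : E (zero_obj C) A).
Proof.
have [Z0 _] := zero_objP A.
apply: (realizes_equiv (realizes_split _ _) (b := pr1 A (zero_obj C))).
- exists (in1 _ _); rewrite pr1_in1; split=> //.
  rewrite -[RHS]dsum_id (_ : pr2 _ _ = 0) ?comp0r ?addr0 //.
  exact: (proj1 (zero_objP _)).
- exact: pr1_in1.
by rewrite comp0l; apply/esym; apply: (proj1 (zero_objP _)).
Qed.

Lemma realizes_0id X : realizes s 0 (idm X) (0 : E X (zero_obj C)).
Proof.
apply: (realizes_equiv (realizes_split _ _) (b := pr2 (zero_obj C) X)).
- exists (in2 _ _); rewrite pr2_in2; split=> //.
  rewrite -[RHS]dsum_id (_ : in1 _ _ = 0) ?comp0l ?add0r //.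
  exact: (proj2 (zero_objP _)).
- by apply: (proj2 (zero_objP _)).
by rewrite comp1m.
Qed.

Section Triangle.
Variables (A B X : C) (x : Mor A B) (y : Mor B X) (d : E X A).
Hypothesis sd : realizes s x y d.

Lemma triangle_comp0 : y \oc x = 0.
Proof.
have [c [_]] := realizes_ET3 (a := idm A) (b := x) (realizes_id0 A) sd erefl.
by rewrite comp0r.
Qed.

(** (ET3) completes [n] to a morphism into the triangle [0 -> Z = Z], whose last component is
    [m]. *)
Lemma triangle_weak_coker Z (n : Mor B Z) : n \oc x = 0 ->
  exists m : Mor X Z, n = m \oc y.
Proof.
move=> nx; have [|m [_]] := realizes_ET3 (a := 0) (b := n) sd (realizes_0id Z).
  by rewrite nx comp0l.
by rewrite comp1m => ?; exists m.
Qed.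

Lemma triangle_weak_ker Z (n : Mor Z B) : y \oc n = 0 ->
  exists m : Mor Z A, n = x \oc m.
Proof.
move=> yn; have [|m [_]] := realizes_ET3op (b := n) (c := 0) (realizes_id0 Z) sd.
  by rewrite yn comp0r.
by rewrite compm1 => ?; exists m.
Qed.

(** The middle map [x \oc pr1 A B + pr2 A B] lies over [y], so the dual of (ET3) gives a morphism
    [(a, y)] from the zero extension of [B] by [A] to [d]; hence the pullback of [d] along [y] is
    [push a 0]. *)
Lemma pull_defl : pull y d = 0.
Proof.
have [|a []] := realizes_ET3op (b := x \oc pr1 A B + pr2 A B) (c := y)
  (realizes_split A B) sd.
  by rewrite compDr compmA triangle_comp0 !dsumE.
by rewrite /ext_morphism /push emap0.
Qed.

Lemma push_infl : push x d = 0.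
Proof.
have [|c []] := realizes_ET3 (a := x) (b := in1 B X + in2 B X \oc y)
  sd (realizes_split B X).
  by rewrite compDl -compmA triangle_comp0 !dsumE.
by rewrite /ext_morphism /pull emap0.
Qed.

(** The difference [b - idm B] factors through [y] and also through [x], so [y \oc x = 0] makes its
    square zero. *)
Lemma triangle_endo_isom (b : Mor B B) : b \oc x = x -> y \oc b = y -> isom b.
Proof.
move=> bx yb; rewrite -[b](subrK (idm B)) addrC.
apply: isom_id_add_square0.
have [|m nE] := triangle_weak_coker (n := b - idm B).
  by rewrite compDl compNl bx comp1m subrr.
have [|m' nE'] := triangle_weak_ker (n := b - idm B).
  by rewrite compDr compNr yb compm1 subrr.
rewrite {1}nE nE' -compmA (compmA y) triangle_comp0.
by rewrite comp0l comp0r.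
Qed.

End Triangle.

(** Both [(a, c)] and its inverse lift to middle maps. Their two composites are compatible with the
    identities at the ends, hence invertible by [triangle_endo_isom]. *)
Lemma triangle_mor_isom A B X A' B' X' (d : E X A) (d' : E X' A')
    (x : Mor A B) (y : Mor B X) (x' : Mor A' B') (y' : Mor B' X')
    (a : Mor A A') (c : Mor X X') :
  realizes s x y d -> realizes s x' y' d' -> ext_morphism d d' a c ->
  isom a -> isom c ->
  exists b : Mor B B', [/\ isom b, b \oc x = x' \oc a & y' \oc b = c \oc y].
Proof.
move=> sd sd' dd' [a' [a'a aa']] [c' [c'c cc']].
have d'd : ext_morphism d' d a' c'.
  rewrite /ext_morphism -[d']emap_id -{1}cc' -[emap _ _ d']pull_emap.
  rewrite -/(pull c d') -dd' push_pull push_push a'a.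
  by rewrite /push emap_id.
have [b [bx yb]] := realizes_mor sd sd' dd'.
have [b' [bx' yb']] := realizes_mor sd' sd d'd.
exists b; split=> //; apply: (isom_of_comps (g := b')).
  apply: (triangle_endo_isom sd).
    by rewrite -compmA bx compmA bx' -compmA a'a compm1.
  by rewrite compmA yb' -compmA yb compmA c'c comp1m.
apply: (triangle_endo_isom sd').
  by rewrite -compmA bx' compmA bx -compmA aa' compm1.
by rewrite compmA yb -compmA yb' compmA cc' comp1m.
Qed.

(** Serves to delete zero summands at the ends of a direct sum of triangles. Any realization of
    [emap c' a d] is compared with the given triangle by [triangle_mor_isom]. *)
Lemma realizes_transport A B X A' X' (x : Mor A B) (y : Mor B X) (d : E X A)
    (a : Mor A A') (a' : Mor A' A) (c : Mor X X') (c' : Mor X' X) :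
  a' \oc a = idm A -> a \oc a' = idm A' -> c' \oc c = idm X -> c \oc c' = idm X' ->
  realizes s x y d -> realizes s (x \oc a') (c \oc y) (emap c' a d).
Proof.
move=> a'a aa' c'c cc' sd.
have [B1 [x1 [y1 sd1]]] := realizes_ex (emap c' a d).
have [|||b [[b' [b'b bb']] bx yb]] := triangle_mor_isom (a := a) (c := c) sd sd1.
- by rewrite /ext_morphism pull_emap c'c.
- by exists a'.
- by exists c'.
apply: (realizes_equiv sd1 (b := b')); first by exists b.
  by rewrite -[x1]compm1 -aa' (compmA x1) -bx !compmA b'b comp1m.
by rewrite -yb -compmA bb' compm1.
Qed.

Lemma zero_summand_r A : in1 A (zero_obj C) \oc pr1 A (zero_obj C) = idm _.
Proof.
rewrite -[RHS]dsum_id (_ : in2 _ _ = 0) ?comp0l ?addr0 //.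
exact: (proj2 (zero_objP _)).
Qed.

(* (ET4) for [A -> A (+) D -> D], split by [(1, -a)], followed by
   [A (+) D -> B (+) D -> X], the sum of [d] and [D = D -> 0]. *)
Lemma pushout_triangle A B X D (x : Mor A B) (y : Mor B X) (d : E X A)
    (a : Mor A D) : realizes s x y d ->
  exists M (i : Mor D M) (p : Mor M X) (j : Mor A (B \+o D)) (q : Mor (B \+o D) M),
    realizes s i p (push a d) /\ realizes s j q (pull p d).
Proof.
move=> sd.
pose f := in1 A D - in2 A D \oc a; pose f' := pr2 A D + a \oc pr1 A D.
have sf : realizes s f f' (0 : E D A).
  (* The shear [b] satisfies [b \oc in1 A D = f] and [f' \oc b = pr2 A D]. *)
  apply: (realizes_equiv (realizes_split A D)
    (b := idm _ - in2 A D \oc a \oc pr1 A D)); last 2 first.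
  - by rewrite /f !dsumE.
  - by rewrite /f' !dsumE subrK.
  exists (idm _ + in2 A D \oc a \oc pr1 A D).
  by rewrite !dsumE addrK subrK.
have sg : realizes s (dsum_mor x (idm D)) (y \oc pr1 B D) (push (in1 A D) d).
  have := realizes_transport (comp1m (idm _)) (comp1m (idm _))
    (zero_summand_r X) (pr1_in1 _ _) (realizes_dsum sd (realizes_id0 D)).
  rewrite compm1 /ext_dsum emapD !emap0 addr0 -emap_comp comp1m pr1_in1.
  by rewrite /dsum_mor !dsumE.
case: ETs => _ _ _ et4 _.
have [M [h' [i [p [d3 [_ sh si _ push_d3]]]]]] := et4 _ _ _ _ _ _ _ _ _ _ _ sf sg.
exists M, i, p, (dsum_mor x (idm D) \oc f), h'; split.
  by move: si; rewrite push_push /f' !dsumE.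
suff -> : pull p d = d3 by [].
(* (ET4) determines [d3] only after pushout along [f]; since [pr1 A D \oc f] is the identity,
   projecting recovers [d3] itself. *)
have := congr1 (push (pr1 A D)) push_d3.
rewrite push_push push_pull push_push /f !dsumE.
by rewrite /push !emap_id => ->.
Qed.

(** The dual of [pushout_triangle]: (ET4)^op is applied to the sum of [d] with [0 -> Y = Y], ending
    in [X (+) Y], followed by the split triangle [Y -> X (+) Y -> X] with maps [(c, 1)] and
    [(1, -c)]. *)
Lemma pullback_triangle A B X Y (x : Mor A B) (y : Mor B X) (d : E X A)
    (c : Mor Y X) : realizes s x y d ->
  exists M (i : Mor A M) (p : Mor M Y) (j : Mor M (B \+o Y)) (q : Mor (B \+o Y) X),
    realizes s i p (pull c d) /\ realizes s j q (push i d).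
Proof.
move=> sd.
pose g' := in2 X Y + in1 X Y \oc c; pose g := pr1 X Y - c \oc pr2 X Y.
have sg : realizes s g' g (0 : E X Y).
  (* The standard split triangle with its summands exchanged; a shear by [c] then turns its maps
     into [g'] and [g]. *)
  have sw : realizes s (in2 X Y) (pr1 X Y) (0 : E X Y).
    apply: (realizes_equiv (realizes_split Y X)
      (b := in1 X Y \oc pr2 Y X + in2 X Y \oc pr1 Y X)).
    - exists (in1 Y X \oc pr2 X Y + in2 Y X \oc pr1 X Y).
      by split; rewrite !dsumE -[RHS]dsum_id addrC.
    - by rewrite !dsumE.
    - by rewrite !dsumE.
  apply: (realizes_equiv sw (b := idm _ + in1 X Y \oc c \oc pr2 X Y)); last 2 first.
  - by rewrite /g' !dsumE.
  - by rewrite /g !dsumE addrK.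
  exists (idm _ - in1 X Y \oc c \oc pr2 X Y).
  by rewrite !dsumE addrK subrK.
have sf : realizes s (in1 B Y \oc x) (dsum_mor y (idm Y)) (pull (pr1 X Y) d).
  have := realizes_transport (zero_summand_r A) (pr1_in1 _ _)
    (comp1m (idm _)) (comp1m (idm _)) (realizes_dsum sd (realizes_0id Y)).
  rewrite comp1m /ext_dsum emapD !emap0 addr0 -emap_comp compm1 pr1_in1.
  by rewrite /dsum_mor !dsumE.
case: ETs => _ _ _ _ et4.
have [M [i [p [h' [d3 [_ sh si _ pull_d3]]]]]] := et4 _ _ _ _ _ _ _ _ _ _ _ sf sg.
exists M, i, p, h', (g \oc dsum_mor y (idm Y)); split.
  by move: si; rewrite pull_pull /g' !dsumE.
suff -> : push i d = d3 by [].
(* Restriction along [in1 X Y], a section of [g], isolates [d3]. *)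
have := congr1 (pull (in1 X Y)) pull_d3.
rewrite -push_pull !pull_pull /g !dsumE.
by rewrite /pull !emap_id => ->.
Qed.

End Extriangulated.

(** * Subgroups generated by a set, as kernels of quotient maps *)

Section GeneratedSubgroups.
Variable V : zmodType.
Implicit Types S T : set V.

Lemma mem_zspan S v : S v -> v \in zspan S.
Proof. by move=> Sv; apply/asboolP => H _; apply. Qed.

Lemma zspan_min S T : (forall v, S v -> v \in zspan T) ->
  forall v, v \in zspan S -> v \in zspan T.
Proof. by move=> ST v /asboolP; apply=> //; apply: zspan_zmod_closed. Qed.

Lemma zmod_proj_eq0 S v : zmod_proj S v = 0 <-> v \in zspan S.
Proof.
rewrite -(raddf0 (zmod_proj S)) -[v in v \in _]subr0 Quotient.idealrBE.
by split=> [/eqP|vS]; last apply/eqP.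
Qed.

End GeneratedSubgroups.

(** * Reduction of triangle classes to Auslander-Reiten classes in the split Grothendieck group *)

Section TriangleClasses.
Variables (K : fieldType) (C : linearCat K) (E : linearBifun C).
Variable s : forall X A : C, E X A -> set (sequence A X).
Arguments s {X A}.
Implicit Types A B X Y : C.

Lemma class0_isomorphic X Y : isomorphic X Y -> class0 X = class0 Y.
Proof. by rewrite /class0 /free_class => /iso_class_of_eq ->. Qed.

Lemma class0_dsum A B : class0 (A \+o B) = class0 A + class0 B.
Proof.
apply/esym/eqP; rewrite -subr_eq0 /class0 -raddfD -raddfB; apply/eqP.
by apply/zmod_proj_eq0/mem_zspan; exists A, B.
Qed.

Hypotheses (ETs : is_extriangulated (@s)) (KS : krull_schmidt C)
  (Efin : forall X A, finite_dimensional (E X A)) (lfC : locally_finite C).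

Lemma split_triangle_class A B X (x : Mor A B) (y : Mor B X) :
  realizes (@s) x y 0 -> class0 B = class0 A + class0 X.
Proof.
move=> s0; rewrite -class0_dsum; apply: class0_isomorphic.
exact: realizes_mid_isomorphic s0 (realizes_split ETs _ _).
Qed.

(** Half of almost splitness is assumed. Pushing out along a suitable [a] supplies the other half
    and keeps the first, as pushouts commute with pullbacks; the class in [K0_split] does not
    change. *)
Lemma AR_class_of_right_minimal A B Y (x : Mor A B) (y : Mor B Y) (d : E Y A) :
    realizes (@s) x y d -> d <> 0 ->
    (forall Z (t : Mor Z Y), ~ split_epi t -> pull t d = 0) ->
  AR_triangle_classes (@s) (class0 A + class0 Y - class0 B).
Proof.
move=> sd d0 pull0; have [G coverG] := finite_target_cover KS lfC A.
(* A socle element of [E(Y, -)]: retractions of [op_cat C] are sections of [C]. *)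
have [W [a [ad0 push0]]] : exists W (a : Mor A W), push a d <> 0 /\
    forall Z (t : Mor W Z), ~ split_mono t -> push t (push a d) = 0.
  have [||||W [a [_ ad0 push0]]] := @socle_element K (op_cat C) (fun Z => E Y (Z : C))
    (fun Z Z' f m => push (f : @Mor K C Z Z') m) _ _ _
    (krull_schmidt_op KS) A d G (Efin Y G) _ d0.
  - by move=> Z m; apply: emap_id.
  - by move=> Z Z' Z'' f g m; rewrite push_push.
  - by move=> Z Z' k f g m; apply: emap_linearr.
  - move=> Z /local_End_op locZ f f0.
    by have [i [p pi]] := coverG Z locZ f f0; exists p, i.
  by exists W, a.
have [M [i [p [j [q [si sj]]]]]] := pushout_triangle ETs a sd.
exists W, M, Y, i, p, (push a d); split=> //.
  by split=> // Z t tN; rewrite -push_pull pull0 // /push emap0.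
(* If [r] were a section of [p], then [push a d] would be the pullback along [r] of its own pullback
   along [p], which is zero. *)
have p0 : pull p d = 0.
  apply: pull0 => -[r pr]; apply: ad0.
  have := congr1 (pull r) (pull_defl ETs si).
  by rewrite pull_pull pr /pull emap_id emap0.
(* The triangle [A -> B (+) W -> M] now splits, so [[A] - [B] = [W] - [M]]. *)
rewrite p0 in sj; have := split_triangle_class sj; rewrite class0_dsum => clE.
have -> : class0 A = class0 B + class0 W - class0 M by rewrite clE addrK.
by rewrite -2!(addrA (class0 B)) [LHS]addrAC subrr add0r addrAC.
Qed.

(** The third term [X] stays fixed while [A], [B] and [d] vary, so the annihilators [N A d] all lie
    in the one space [Mor G X] and can be compared by rank. *)
Lemma triangle_classes_in_AR_span
    (Cfin : forall X Y : C, finite_dimensional (Mor X Y)) X :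
  forall A B (x : Mor A B) (y : Mor B X) (d : E X A), realizes (@s) x y d ->
  class0 A + class0 X - class0 B \in zspan (AR_triangle_classes (@s)).
Proof.
have [G coverG] := finite_source_cover KS lfC X.
have [n [mu [mu_le mu_lt]]] := finite_dimensional_rank (Cfin G X).
pose N A (d : E X A) : set (Mor G X) := [set z | pull z d = 0].
have subN A (d : E X A) : subspace (N A d).
  split=> [|k u v]; first exact: emap0l.
  by rewrite /N /= /pull emap_linearl => -> ->; rewrite scaler0 addr0.
suff step m A B (x : Mor A B) (y : Mor B X) (d : E X A) :
    realizes (@s) x y d -> (n - mu (N A d) < m)%N ->
    class0 A + class0 X - class0 B \in zspan (AR_triangle_classes (@s)).
  by move=> A B x y d sd; apply: step sd (ltnSn _).
elim: m A B x y d => // m IHm A B x y d sd; rewrite ltnS => le_m.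
have [d0|d0] := pselect (d = 0).
  rewrite d0 in sd; rewrite (split_triangle_class sd) subrr.
  by case: (zspan_zmod_closed (AR_triangle_classes (@s))).
have [|||Y [c [locY cd0 pull0]]] := @socle_element K C (fun Z => E Z A)
  (fun Z Z' f m => pull f m) _ _ _ KS X d G (Efin G A) coverG d0.
- by move=> Z e; apply: emap_id.
- by move=> Z Z' Z'' f g e; rewrite pull_pull.
- by move=> Z Z' k f g e; apply: emap_linearl.
have [M [i [p [j [q [si sj]]]]]] := pullback_triangle ETs c sd.
(* The triangles [A -> M -> Y] of [pull c d] and [M -> B (+) Y -> X] of [push i d]: the terms [M]
   and [Y] cancel. *)
have -> : class0 A + class0 X - class0 B =
    (class0 M + class0 X - class0 (B \+o Y)) + (class0 A + class0 Y - class0 M).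
  rewrite [RHS]addrC !addrA subrK class0_dsum opprD addrA.
  by rewrite (addrAC (class0 A) (class0 Y)) (addrAC _ (class0 Y)) addrK.
have c0 : c <> 0 by move=> c0; apply: cd0; rewrite c0 /pull emap0l.
have [u [v vu]] := coverG Y locY c c0.
apply: rpredD; last by apply/mem_zspan/(AR_class_of_right_minimal si).
suff lt_mu : (mu (N A d) < mu (N M (push i d)))%N.
  apply: (IHm _ _ _ _ _ sj); apply: leq_trans le_m.
  (* The truncated difference really drops because [mu (N A d) < n]. *)
  exact: ltn_sub2l (leq_trans lt_mu (mu_le _)) lt_mu.
(* The new annihilator contains [c \oc v], because [push i] kills [pull c d]. The old one does not:
   [v \oc u = idm Y] would force [pull c d = 0]. *)
apply: mu_lt => // [z|/(_ (c \oc v)) Ncv].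
  by rewrite /N /= -push_pull => ->; rewrite /push emap0.
apply: cd0; rewrite -[c]compm1 -vu compmA -pull_pull Ncv /N /=; first exact: emap0.
by rewrite -push_pull -pull_pull push_pull (push_infl ETs si) /pull emap0.
Qed.

End TriangleClasses.

Theorem theorem4p4 (K : fieldType) (C : linearCat K) (E : linearBifun C)
    (s : forall X A : C, E X A -> set (sequence A X)) :
  is_extriangulated s ->
  krull_schmidt C ->
  (forall X Y : C, finite_dimensional (Mor X Y)) ->
  (forall X Y : C, finite_dimensional (E X Y)) ->
  ~ (forall X : C, projective_obj s X /\ injective_obj s X) ->
  locally_finite C ->
  forall v : K0_split C,
    K0_proj s v = 0 <-> v \in zspan (AR_triangle_classes s).
Proof.
move=> ETs KS Cfin Efin _ lfC v.
(* The kernel is the span of all triangle classes; both inclusions between the two spans are checked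
   on generators. *)
apply: iff_trans (zmod_proj_eq0 _ _) _; split; apply: zspan_min.
  move=> _ [A [B [X [x [y [d [sd ->]]]]]]].
  exact: triangle_classes_in_AR_span sd.
move=> u [A [B [X [x [y [d [sd _ ->]]]]]]].
by apply: mem_zspan; exists A, B, X, x, y, d.
Qed.
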